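(* Let $T$ be a tree with $n$ vertices and independence number $\alpha$. Then \[ mis(T) \geq f(n-\alpha+2). \] Moreover, this inequality is sharp: for every integer $n \geq 2$ and every integer $\alpha$ with $\lceil n/2 \rceil \leq \alpha \leq n-1$, there exists a tree with $n$ vertices and independence number $\alpha$ for which equality holds.
   Context: All graphs are simple and finite. An independent set of a graph $G$ is a set of pairwise non-adjacent vertices; a maximal independent set is an independent set not properly contained in another independent set. $mis(G)$ denotes the number of maximal independent sets of $G$, and the independence number $\alpha(G)$ is the maximum size of an independent set. $f(n)$ denotes the $n$th Fibonacci number: $f(0)=0$, $f(1)=1$, and $f(n)=f(n-1)+f(n-2)$ for $n\geq 2$. *)

(* Defs.v *)
From mathcomp Require Import all_boot.

Set Implicit Arguments.
Unset Strict Implicit.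
Unset Printing Implicit Defensive.

Fixpoint fib (n : nat) : nat :=
  match n with
  | 0 => 0
  | 1 => 1
  | (m.+1 as k).+1 => fib k + fib m
  end.

Record sgraph := SGraph {
  vertex :> finType;
  edge : rel vertex;
  edge_sym : symmetric edge;
  edge_irrefl : irreflexive edge
}.

Definition connected_graph (G : sgraph) : Prop :=
  0 < #|{: G}| /\ forall x y : G, connect (@edge G) x y.

(* An edge x y yields the length-2 [ucycle] [:: x; y], which is not a cycle
   in the graph-theoretic sense, hence the bound on the length. *)
Definition acyclic_graph (G : sgraph) : Prop :=
  forall c : seq G, 2 < size c -> ~ ucycle (@edge G) c.

Definition tree (G : sgraph) : Prop := connected_graph G /\ acyclic_graph G.

Definition independent (G : sgraph) (S : {set G}) : bool :=
  [forall x in S, forall y in S, ~~ edge x y].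

Definition independence_number (G : sgraph) : nat :=
  \max_(S : {set G} | independent S) #|S|.

Definition mis (G : sgraph) : nat :=
  #|[set S : {set G} | maxset (@independent G) S]|.

(* Main.v *)
Require Import Defs.
From mathcomp Require Import all_boot zify.

(** Lower bound, for every induced subgraph [A] of a forest.  Let [v] be the
    second vertex of a longest path of [A] and [u] the third one.  All
    neighbours of [v] other than [u] are leaves; call [L] the set of these.
    Adding [L] to a maximal independent set of [A - v - L], or [v] to one of
    [A - v - L - u], gives a maximal independent set of [A], and the two kinds
    differ on [v].  As [alpha] drops by at least [#|L|], the difference of order
    and independence number drops by at most 1, respectively 2, which is the
    Fibonacci recursion.

    Sharpness.  Attach [alpha] leaves to a path on [k = n - alpha] vertices,
    each of which receives at least one.  A maximal independent set is
    determined by its trace on the path, which is an independent set of the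
    path, and a path on [k] vertices has [fib (k + 2)] independent sets. *)

Set Implicit Arguments.
Unset Strict Implicit.
Unset Printing Implicit Defensive.

Lemma fibSS m : fib m.+2 = fib m.+1 + fib m.
Proof. by []. Qed.

Lemma leq_fib : {homo fib : m n / m <= n}.
Proof.
apply: homo_leq => //; first exact: leq_trans.
by case=> // m; rewrite fibSS leq_addr.
Qed.

(** * Maximal independent sets of induced subgraphs *)

Section InducedSubgraph.

Variable G : sgraph.
Implicit Types (A B C L S : {set G}) (x y : G) (p : seq G).

Lemma independentP S :
  reflect {in S &, forall x y, ~~ edge x y} (independent S).
Proof.
apply: (iffP forall_inP) => [h x y xS yS | h x xS].
  by move/forall_inP: (h x xS); apply.
by apply/forall_inP => y yS; apply: h.
Qed.

(** Maximality is expressed as domination inside the subgraph induced on [A]. Keeping [A] a vertex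
    subset of [G] lets the induction delete vertices without changing the graph type. *)
Definition is_mis A S :=
  [&& S \subset A, independent S &
      [forall x in A :\: S, [exists y in S, edge x y]]].

Definition alpha_in A := \max_(S : {set G} | (S \subset A) && independent S) #|S|.

Lemma is_misP A S :
  reflect [/\ S \subset A, independent S &
              forall x, x \in A -> x \notin S -> exists2 y, y \in S & edge x y]
          (is_mis A S).
Proof.
apply: (iffP and3P) => -[sSA indS].
  move=> /forall_inP h; split=> // x xA xS.
  by apply/exists_inP/h; rewrite inE xS.
move=> h; split=> //; apply/forall_inP => x; rewrite inE => /andP[xS xA].
exact/exists_inP/h.
Qed.

(** A vertex without neighbour in an independent set can be added to it; conversely, a set that
    dominates every other vertex has no larger independent superset. *)
Lemma maxset_independentE S : maxset (@independent G) S = is_mis setT S.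
Proof.
apply/maxsetP/is_misP => [[indS maxS] | [_ indS domS]].
  split=> [||x _ xS]; rewrite ?subsetT //.
  apply/exists_inP; apply: contraR xS => /exists_inPn h.
  rewrite -(maxS (x |: S)) ?setU11 ?subsetUr //.
  apply/independentP => a b; rewrite !inE.
  case/predU1P => [->|aS] /predU1P[->|bS].
  - by rewrite edge_irrefl.
  - exact: h.
  - by rewrite edge_sym; apply: h.
  - by move/independentP: indS; apply.
split=> // B /independentP indB sSB; apply/eqP; rewrite eqEsubset sSB andbT.
apply/subsetP => x xB; apply: contraT => xS.
have [//|y yS xy] := domS x _ xS.
by have := indB x y xB (subsetP sSB _ yS); rewrite xy.
Qed.

Lemma mis_setT : mis G = #|[set S | is_mis setT S]|.
Proof. by apply: eq_card => S; rewrite !inE maxset_independentE. Qed.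

Lemma alpha_in_setT : independence_number G = alpha_in setT.
Proof. by apply: eq_bigl => S; rewrite subsetT. Qed.

Lemma alpha_in_attained A :
  exists2 S : {set G}, (S \subset A) && independent S & alpha_in A = #|S|.
Proof.
have P0 : (set0 \subset A) && independent (set0 : {set G}).
  by rewrite sub0set; apply/independentP => x y; rewrite inE.
by have [S PS maxS] := @eq_bigmax_cond _
  [pred S : {set G} | (S \subset A) && independent S] (fun S : {set G} => #|S|)
  (introT card_gt0P (ex_intro _ (set0 : {set G}) P0)); exists S.
Qed.

Lemma leq_alpha_in A S : S \subset A -> independent S -> #|S| <= alpha_in A.
Proof.
move=> sSA indS.
by apply: (@leq_bigmax_cond _ _ (fun S : {set G} => #|S|)); rewrite sSA.
Qed.

Lemma alpha_in_sub A B : A \subset B -> alpha_in A <= alpha_in B.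
Proof.
move=> sAB; have [S /andP[sSA indS] ->] := alpha_in_attained A.
by rewrite leq_alpha_in // (subset_trans sSA).
Qed.

(** * Longest paths in forests *)

Lemma acyclic_no_chord x y w p :
    acyclic_graph G -> uniq (x :: y :: p) -> path (@edge G) x (y :: p) ->
  edge x w -> w \notin p.
Proof.
move=> acG up pp xw; apply/negP => wp; case/splitPr: wp up pp => p1 p2.
rewrite -cat_rcons -!cat_cons cat_uniq cat_path => /andP[up _] /andP[pp _].
(* The chord from [x] to [w] closes this cycle; since [y] lies between them, it has at least three
   vertices. *)
apply: (acG (x :: y :: rcons p1 w)); first by rewrite /= size_rcons.
by rewrite /ucycle up andbT /cycle rcons_path pp /= last_rcons edge_sym xw.
Qed.

Definition path_in A p := [&& uniq p, sorted (@edge G) p & all (mem A) p].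

Definition longest_path_in A p :=
  path_in A p /\ forall q, path_in A q -> size q <= size p.

Lemma longest_path_in_exists A : exists p, longest_path_in A p.
Proof.
pose P k := [exists t : k.-tuple G, path_in A t].
have exP : exists k, P k by exists 0; apply/existsP; exists [tuple].
have ubP k : P k -> k <= #|G|.
  case/existsP => t /and3P[ut _ _].
  by rewrite -(size_tuple t) -(card_uniqP ut) max_card.
case: (ex_maxnP exP ubP) => k /existsP[t tP] maxk.
exists t; split=> // q qP; rewrite size_tuple; apply: maxk.
by apply/existsP; exists (in_tuple q).
Qed.

(** Any other neighbour of the head lies off the path, as there are no chords, and so would extend
    it. *)
Lemma longest_path_head_leaf A x y p w :
    acyclic_graph G -> longest_path_in A (x :: y :: p) ->
  w \in A -> edge x w -> w = y.
Proof.
move=> acG [/and3P[up pp allp] maxp] wA xw; apply/eqP; apply: contraT => wy.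
have wNp := acyclic_no_chord acG up pp xw.
have wNx : w != x by apply: contraTneq xw => ->; rewrite edge_irrefl.
suff /maxp : path_in A (w :: x :: y :: p) by rewrite ltnn.
apply/and3P; split.
- by rewrite cons_uniq !inE !negb_or wNx wy wNp.
- by move: pp; rewrite /= => ->; rewrite edge_sym xw.
- by move: allp => /= ->; rewrite wA.
Qed.

(** Take a longest path [x :: v :: u :: _]. A neighbour [w] of [v] other than [u] can replace [x] as
    its head, which gives another longest path, so [w] is a leaf too. *)
Lemma exists_near_leaf A :
    acyclic_graph G -> ~~ independent A ->
  exists v u x, [/\ v \in A, x \in A, edge v x, x != u &
    forall w z, w \in A -> edge v w -> w != u ->
                z \in A -> edge w z -> z = v].
Proof.
move=> acG nindA; have [p lp] := longest_path_in_exists A.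
have [a aA [b bA ab]] : exists2 a, a \in A & exists2 b, b \in A & edge a b.
  case/forall_inPn: nindA => a aA /forall_inPn[b bA /negPn ab].
  by exists a => //; exists b.
have : 1 < size p.
  apply: (lp.2 [:: a; b]); apply/and3P; split; rewrite /= ?ab ?aA ?bA //.
  by rewrite inE andbT; apply: contraTneq ab => ->; rewrite edge_irrefl.
case: p lp => [|x [|v p]] // lp _; have [/and3P[up pp allp] maxp] := lp.
have [xA vA] : x \in A /\ v \in A by case/and3P: allp.
have vx : edge v x by rewrite edge_sym; case/andP: pp.
(* If the path has only two vertices, [u] defaults to [v], which is not its own neighbour, so
   [w != u] then excludes no neighbour of [v]. *)
exists v, (head v p), x; split=> //.
  move: up; case: (p) => [|u q] /=; rewrite !inE ?negb_or.
    by case/andP.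
  by case/andP => /and3P[].
move=> w z wA vw wu zA wz; apply: (@longest_path_head_leaf A w v p) => //.
split; last exact: maxp.
have wNv : w != v by apply: contraTneq vw => ->; rewrite edge_irrefl.
apply/and3P; split.
- have upv : uniq (v :: p) by case/andP: up.
  rewrite cons_uniq upv inE negb_or wNv /= andbT.
  case: p wu upv pp {lp up allp maxp} => //= u q wu upv /and3P[_ vu pq].
  rewrite inE negb_or wu; apply: (@acyclic_no_chord v u) => //.
  by rewrite /= vu.
- by move: pp; rewrite /= => /andP[_ ->]; rewrite edge_sym vw.
- by move: allp => /= /andP[_ ->]; rewrite wA.
Qed.

(** * Fibonacci recursion and the lower bound *)

Lemma independent_setU_leaves A v L S :
    L \subset A :\ v ->
    (forall w z, w \in L -> z \in A -> edge w z -> z = v) ->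
    S \subset A :\ v :\: L -> independent S ->
  independent (L :|: S).
Proof.
move=> sLA leafL sSA /independentP indS.
(* A vertex of [L] has no neighbour in [A] but [v], and [v] is outside the union. *)
have LNe a b : a \in L -> b \in L :|: S -> ~~ edge a b.
  move=> aL bLS; have /setD1P[bv bA] : b \in A :\ v.
    case/setUP: bLS => [/(subsetP sLA)|/(subsetP sSA)] //.
    by rewrite inE => /andP[].
  by apply: contra_neqN bv => /leafL; apply.
apply/independentP => a b /setUP[aL|aS]; first exact: LNe.
case/setUP => [bL|bS]; last exact: indS.
by rewrite edge_sym LNe // inE aS orbT.
Qed.

(** The only vertex of [A] that still needs a neighbour is [v], and any element of the nonempty [L]
    provides it. *)
Lemma is_mis_setU_leaves A v L S :
    v \in A -> L \subset A :\ v -> L != set0 -> {in L, forall w, edge v w} ->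
    (forall w z, w \in L -> z \in A -> edge w z -> z = v) ->
  is_mis (A :\ v :\: L) S -> is_mis A (L :|: S).
Proof.
move=> vA sLA /set0Pn[x xL] vL leafL /is_misP[sSA indS domS].
apply/is_misP; split; last 1 first.
- move=> z zA; rewrite inE negb_or => /andP[zL zS].
  have [->|zv] := eqVneq z v; first by exists x; rewrite ?inE ?xL ?vL.
  have [|y yS zy] := domS z _ zS; first by rewrite !inE zL zv.
  by exists y; rewrite // inE yS orbT.
- rewrite subUset (subset_trans sLA) ?subsetDl //=.
  by rewrite (subset_trans sSA) // setDDl subsetDl.
- exact: independent_setU_leaves leafL sSA indS.
Qed.

(** The vertices removed along with [v] are its neighbours, hence dominated by [v]. *)
Lemma is_mis_setU1 A v S :
    v \in A -> is_mis [set w in A :\ v | ~~ edge v w] S -> is_mis A (v |: S).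
Proof.
move=> vA /is_misP[sSA /independentP indS domS].
have Sv w : w \in S -> (w \in A) && ~~ edge v w.
  by move=> wS; have := subsetP sSA w wS; rewrite !inE => /andP[/andP[_ ->]].
apply/is_misP; split.
- by rewrite subUset sub1set vA; apply/subsetP => w /Sv/andP[].
- apply/independentP => a b; rewrite !inE.
  case/predU1P => [->|aS] /predU1P[->|bS].
  + by rewrite edge_irrefl.
  + by case/andP: (Sv b bS).
  + by rewrite edge_sym; case/andP: (Sv a aS).
  + exact: indS.
- move=> z zA; rewrite !inE negb_or => /andP[zv zS].
  have [vz|vz] := boolP (edge v z).
    by exists v; rewrite ?setU11 // edge_sym.
  have [|y yS zy] := domS z _ zS; first by rewrite !inE zv zA.
  by exists y; rewrite // setU1r.
Qed.

(** Both extension maps are injective, and their images are disjoint because only the second kind of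
    set contains [v]. *)
Lemma leq_card_mis_split A B C v L :
    v \notin A -> v \notin C -> v \notin L -> [disjoint L & A] ->
    (forall S, is_mis A S -> is_mis B (L :|: S)) ->
    (forall S, is_mis C S -> is_mis B (v |: S)) ->
  #|[set S | is_mis A S]| + #|[set S | is_mis C S]| <= #|[set S | is_mis B S]|.
Proof.
move=> vA vC vL dLA AB CB.
have sub_notin (X : {set G}) x S : x \notin X -> is_mis X S -> x \notin S.
  by move=> xX /is_misP[sSX _ _]; apply: contra xX; apply: subsetP.
rewrite -(@card_in_imset _ _ (fun S => L :|: S)); last first.
  move=> S S'; rewrite !inE => /is_misP[sS _ _] /is_misP[sS' _ _] eqS.
  have setK (X : {set G}) : X \subset A -> (L :|: X) :\: L = X.
    move=> sX; rewrite setDUl setDv set0U; apply/setDidPl.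
    by rewrite disjoint_sym (disjointWr sX).
  by rewrite -(setK S) // eqS setK.
rewrite -[X in _ + X](@card_in_imset _ _ (fun S => v |: S)); last first.
  move=> S S'; rewrite !inE => /(sub_notin _ _ _ vC) vS.
  by move=> /(sub_notin _ _ _ vC) vS' eqS; rewrite -(setU1K vS) eqS setU1K.
set X := imset _ _; set Y := imset _ _.
have dXY : [disjoint X & Y].
  apply/pred0P => S /=; apply/negP => /andP[/imsetP[S1]].
  rewrite inE => /(sub_notin _ _ _ vA) vS1 -> /imsetP[S2 _] /setP/(_ v).
  by rewrite !inE eqxx (negPf vS1) (negPf vL).
have /eqP <- : #|X :|: Y| == #|X| + #|Y| by rewrite leq_card_setU.
apply: subset_leq_card; rewrite subUset.
by apply/andP; split; apply/subsetP => _ /imsetP[S + ->]; rewrite !inE;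
  [apply: AB | apply: CB].
Qed.

(** Arbitrary vertex subsets are needed for the induction, since deleting vertices can disconnect a
    tree. *)
Theorem fib_leq_card_mis A :
  acyclic_graph G -> fib (#|A| - alpha_in A + 2) <= #|[set S | is_mis A S]|.
Proof.
move=> acG; have [m] := ubnP #|A|; elim: m A => // m IHm A; rewrite ltnS => ltAm.
have [indA|nindA] := boolP (independent A).
  (* Here the bound is [fib 2 = 1], witnessed by [A] itself. *)
  have /eqP -> : #|A| - alpha_in A == 0 by rewrite subn_eq0 leq_alpha_in.
  apply/card_gt0P; exists A; rewrite inE.
  by apply/is_misP; split=> // x ->.
have [v [u [x [vA xA vx xu leaf]]]] := exists_near_leaf acG nindA.
pose L := [set w in A | edge v w & w != u].
have vL : v \notin L by rewrite inE edge_irrefl andbF.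
have sLA : L \subset A :\ v.
  apply/subsetP => w wL; rewrite !inE; have := wL; rewrite inE => /andP[-> _].
  by rewrite andbT; apply: contraNneq vL => <-.
(* [A2] drops all neighbours of [v]; compared with [A1], it can only lose [u]. *)
pose A1 := A :\ v :\: L; pose A2 := [set w in A :\ v | ~~ edge v w].
have cardA : #|A| = (#|A1| + #|L|).+1.
  have := cardsD1 v A; have := cardsD (A :\ v) L; have := subset_leq_card sLA.
  by rewrite vA (setIidPr sLA) -/A1; lia.
have sA21 : A2 \subset A1.
  by apply/subsetP => w; rewrite !inE => /andP[-> /negPf->]; rewrite andbF.
have cardA1 : #|A1| <= #|A2|.+1.
  apply: leq_trans (_ : #|u |: A2| <= _); last first.
    by rewrite cardsU1; case: (_ \notin _).
  apply: subset_leq_card; apply/subsetP => w.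
  rewrite !inE => /and3P[+ -> wA]; rewrite wA /= negb_and negbK.
  by case/orP => [->|/eqP->]; rewrite ?orbT ?eqxx.
have leafL w z : w \in L -> z \in A -> edge w z -> z = v.
  by rewrite inE => /and3P[wA vw wu]; apply: leaf.
have alphaA : alpha_in A1 + #|L| <= alpha_in A.
  have [S /andP[sSA indS] ->] := alpha_in_attained A1.
  have dLS : [disjoint S & L].
    by move: sSA; rewrite subsetD => /andP[].
  have /eqP <- : #|S :|: L| == #|S| + #|L| by rewrite leq_card_setU.
  rewrite setUC leq_alpha_in //; last first.
    exact: independent_setU_leaves leafL sSA indS.
  rewrite subUset (subset_trans sLA) ?subsetDl //=.
  by rewrite (subset_trans sSA) // /A1 setDDl subsetDl.
have misA : #|[set S | is_mis A1 S]| + #|[set S | is_mis A2 S]|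
              <= #|[set S | is_mis A S]|.
  apply: (@leq_card_mis_split _ _ _ v L) => //.
  - by rewrite !inE eqxx andbF.
  - by rewrite !inE eqxx.
  - by rewrite -setI_eq0 /A1 setDE setICA setICr setI0.
  - move=> S; apply: is_mis_setU_leaves => //.
      by apply/set0Pn; exists x; rewrite !inE xA vx.
    by move=> w; rewrite inE => /and3P[].
  - by move=> S; apply: is_mis_setU1.
apply: leq_trans misA.
have alphaA2 := alpha_in_sub sA21.
have cardA2 := subset_leq_card sA21.
apply: leq_trans (leq_add (IHm A1 _) (IHm A2 _)); try lia.
(* With [d = #|A1| - alpha_in A1], the difference for [A] is at most [d + 1] and that for [A2] at
   least [d - 1], so [fib (d + 3) = fib (d + 2) + fib (d + 1)] concludes. *)
apply: leq_trans (_ : fib (#|A1| - alpha_in A1).+3 <= _).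
  by apply: leq_fib; lia.
by rewrite fibSS addn2 leq_add2l; apply: leq_fib; lia.
Qed.

End InducedSubgraph.

(** * Independent sets of a path, as boolean words *)

Section IndependentSetsOfPath.

Definition sparse (s : seq bool) := sorted (fun b c => ~~ (b && c)) s.

(** A leading [true] forces a following [false], so the two are peeled together and the lengths
    follow the recursion of [fib]. Length 1 is a base case because [[:: true]] has no second
    letter. *)
Fixpoint sparse_seqs (k : nat) : seq (seq bool) :=
  match k with
  | 0 => [:: [::]]
  | 1 => [:: [:: false]; [:: true]]
  | (m.+1 as k').+1 =>
      map (cons false) (sparse_seqs k') ++
      map (fun s => [:: true, false & s]) (sparse_seqs m)
  end.

Lemma sparse_seqsSS k :
  sparse_seqs k.+2 = map (cons false) (sparse_seqs k.+1) ++
                     map (fun s => [:: true, false & s]) (sparse_seqs k).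
Proof. by []. Qed.

Lemma size_sparse_seqs k : size (sparse_seqs k) = fib k.+2.
Proof.
have [m] := ubnP k; elim: m k => // m IHm [|[|k]] // lekm.
by rewrite sparse_seqsSS fibSS size_cat !size_map !IHm // ltnW.
Qed.

Lemma sparse_seqsP s : sparse s -> s \in sparse_seqs (size s).
Proof.
have [m] := ubnP (size s); elim: m s => // m IHm [|b [|c s]] //.
  by case: b.
rewrite ltnS => lesm; have {}lesm : (size s).+1 < m by [].
case/andP=> bc sp; rewrite sparse_seqsSS mem_cat; case: b bc => [|_]; last first.
  by rewrite map_f ?IHm.
case: c sp => // /path_sorted sp _; rewrite orbC.
by rewrite (map_f (fun s => [:: true, false & s])) // IHm // ltnW.
Qed.

End IndependentSetsOfPath.

(** * The extremal trees *)

Section Caterpillar.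

Variables k n : nat.
Hypotheses (k_gt0 : 0 < k) (lekn : k.*2 <= n).

(* The path is [0, ..., k - 1], rooted at [0], and the leaf [k + j] hangs
   from [min j (k - 1)]; note that [0] is its own parent. *)
Definition parent i := if i < k then i.-1 else minn (i - k) k.-1.

Definition caterpillar_edge : rel 'I_n :=
  fun i j => (i != j) && ((parent i == j) || (parent j == i)).

Lemma caterpillar_edge_sym : symmetric caterpillar_edge.
Proof. by move=> i j; rewrite /caterpillar_edge eq_sym orbC. Qed.

Lemma caterpillar_edge_irrefl : irreflexive caterpillar_edge.
Proof. by move=> i; rewrite /caterpillar_edge eqxx. Qed.

Definition caterpillar := SGraph caterpillar_edge_sym caterpillar_edge_irrefl.

Lemma parent_lt i : 0 < i -> parent i < i.
Proof. rewrite /parent; case: (ltnP i k); lia. Qed.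

Lemma parent_ltk i : parent i < k.
Proof. rewrite /parent; case: (ltnP i k); lia. Qed.

(** Parents are smaller than their children, except for the root, which is its own parent; so the
    larger end of an edge is the child. *)
Lemma caterpillar_edge_lt (i j : 'I_n) :
  caterpillar_edge i j -> j < i -> parent i = j.
Proof.
case/andP=> _ /orP[/eqP //|/eqP pji] ltji.
have [j0|/parent_lt] := posnP j; last lia.
by move: pji; rewrite j0 /parent k_gt0; lia.
Qed.

Lemma caterpillar_connected : connected_graph caterpillar.
Proof.
have n_gt0 : 0 < n by lia.
pose z : 'I_n := Ordinal n_gt0.
(* Iterating [parent] decreases the index until it reaches the root. *)
have connz (x : 'I_n) : connect caterpillar_edge x z.
  have [m] := ubnP x; elim: m x => // m IHm x; rewrite ltnS => lexm.
  have [x0|x_gt0] := posnP x; first by rewrite (_ : x = z) //; apply/val_inj.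
  have ltpx := parent_lt x_gt0.
  pose y : 'I_n := Ordinal (ltn_trans ltpx (ltn_ord x)).
  apply: connect_trans (IHm y _); last exact: leq_trans ltpx lexm.
  apply: connect1; rewrite /caterpillar_edge eqxx andbT.
  by apply: contraTneq (ltpx) => /(congr1 val) /= <-; rewrite ltnn.
split; first by rewrite card_ord.
move=> x y; apply: connect_trans (connz x) _.
by rewrite (sym_connect_sym caterpillar_edge_sym).
Qed.

Lemma caterpillar_acyclic : acyclic_graph caterpillar.
Proof.
(* Both neighbours of the largest vertex of a cycle would be its parent. *)
move=> c sz_c uc; have [x0 x0c] : exists x0, x0 \in c.
  by case: c sz_c {uc} => // x c; exists x; rewrite mem_head.
have [x xc maxx] := @arg_maxnP _ x0 (mem c) (@nat_of_ord n) x0c.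
have [i s def_c] := rot_to xc.
have memc y : (y \in c) = (y \in x :: s) by rewrite -def_c mem_rot.
move: uc sz_c; rewrite -(rot_ucycle i) -(size_rot i) def_c => /andP[cyc ucs].
have below (y : 'I_n) : y \in c -> caterpillar_edge x y -> parent x = y.
  move=> yc xy; apply: caterpillar_edge_lt => //.
  rewrite ltn_neqAle (maxx y yc : y <= x) andbT.
  by apply: contraTneq xy => /val_inj ->; rewrite caterpillar_edge_irrefl.
case: s memc cyc ucs {def_c} => [|y s] // memc.
case/lastP: s memc => [|s z] // memc.
rewrite /= rcons_path last_rcons => /and3P[xy _ zx] /and3P[_ yz _] _.
have py := below y _ xy; rewrite memc !inE eqxx orbT in py.
have pz : parent x = z.
  apply: below; last by rewrite caterpillar_edge_sym.
  by rewrite memc !inE mem_rcons mem_head !orbT.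
move: yz; rewrite mem_rcons inE negb_or => /andP[/eqP[]].
by apply/val_inj; rewrite /= -py // -pz.
Qed.

Lemma caterpillar_tree : tree caterpillar.
Proof. by split; [apply: caterpillar_connected | apply: caterpillar_acyclic]. Qed.

Definition leaves : {set caterpillar} := [set i : 'I_n | k <= i].

Lemma card_leaves : #|leaves| = n - k.
Proof.
have lekn' : k <= n by lia.
have <- : #|~: leaves| = k.
  have inj : injective (widen_ord lekn') by move=> i j [] /val_inj.
  rewrite -[RHS](card_ord k) -(card_imset _ inj).
  apply: eq_card => i; rewrite !inE -ltnNge; apply/idP/imsetP => [ltik|[j _ ->]].
    by exists (Ordinal ltik) => //; apply/val_inj.
  by rewrite /= ltn_ord.
have := cardsC leaves; rewrite card_ord; lia.
Qed.

Lemma caterpillar_alpha : independence_number caterpillar = n - k.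
Proof.
apply/eqP; rewrite eqn_leq; apply/andP; split; last first.
  rewrite -card_leaves; apply: (@leq_bigmax_cond _ _ (fun S : {set _} => #|S|)).
  apply/independentP => i j; rewrite !inE => ki kj; apply/negP => /andP[_].
  by have := parent_ltk i; have := parent_ltk j; lia.
apply/bigmax_leqP => S /independentP indS; rewrite -card_leaves.
(* The matching [{i, k + i}] bounds the size of independent sets. *)
pose f (i : 'I_n) : 'I_n := insubd i (if i < k then k + i else i).
have fE i : f i = (if i < k then k + i else i) :> nat.
  rewrite val_insubd; have := ltn_ord i.
  by case: (ltnP i k) => [ltik|leki] ltin; case: ifP => //; lia.
have noedge (i j : 'I_n) : i \in S -> j \in S -> i < k -> k + i <> j.
  move=> iS jS ltik eqj; apply/negP: (indS _ _ iS jS); rewrite /= negbK.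
  apply/andP; split; first by apply/eqP => /(congr1 val) /=; lia.
  apply/orP; right; rewrite /parent -eqj; apply/eqP.
  by case: (ltnP (k + i) k); lia.
(* [f] moves path vertices to their matched leaves and fixes leaves; it is injective on [S] because
   [S] never contains both ends of a matching edge. *)
rewrite -(@card_in_imset _ _ f) => [|i j iS jS /(congr1 val) /=]; last first.
  rewrite !fE => eqf; apply/val_inj; move: eqf => /=.
  have := noedge i j iS jS; have := noedge j i jS iS.
  by case: (ltnP i k) => ?; case: (ltnP j k) => ?; lia.
apply: subset_leq_card; apply/subsetP => _ /imsetP[i iS ->].
by rewrite inE fE; case: (ltnP i k); lia.
Qed.

(** Vertices are compared as numbers, so no ordinal has to be built from each position. *)
Definition trace (S : {set caterpillar}) : seq bool :=
  mkseq (fun i => [exists j in S, nat_of_ord j == i]) k.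

Lemma nth_trace S (i : 'I_n) : i < k -> nth false (trace S) i = (i \in S).
Proof.
move=> ltik; rewrite nth_mkseq //.
apply/exists_inP/idP => [[j jS /eqP/val_inj <-] //|iS].
by exists i.
Qed.

Lemma trace_sparse S : independent S -> sparse (trace S).
Proof.
move=> /independentP indS; apply/(sortedP false) => i.
rewrite size_mkseq => ltik; have [lti ltSi] : i < n /\ i.+1 < n by lia.
rewrite (@nth_trace S (Ordinal lti)) ?(@nth_trace S (Ordinal ltSi)) //=; last exact: ltnW.
apply/negP => /andP[iS SiS]; apply/negP: (indS _ _ iS SiS); rewrite negbK.
apply/andP; split; first by apply/eqP => /(congr1 val) /=; lia.
by rewrite /parent /= ltik eqxx orbT.
Qed.

(** The only neighbour of a leaf is its parent, so a leaf is in a maximal independent set exactly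
    when its parent is not, and the path part determines the rest. *)
Lemma trace_inj_mis :
  {in [set S : {set caterpillar} | is_mis setT S] &, injective trace}.
Proof.
have leaf_in (S : {set caterpillar}) (i : 'I_n) (p : 'I_n) :
    is_mis setT S -> parent i = p -> k <= i -> (i \in S) = (p \notin S).
  move=> /is_misP[_ /independentP indS domS] pi leki.
  have ip : @edge caterpillar i p.
    rewrite /= /caterpillar_edge pi eqxx andbT.
    by apply: contraTneq leki => ->; rewrite -ltnNge -pi parent_ltk.
  apply/idP/idP => [iS|]; first by apply: contraL ip; apply: indS.
  apply: contraR => iS; have [//|q qS /andP[_]] := domS i _ iS.
  case/orP => /eqP; first by rewrite pi => /val_inj ->.
  (* Otherwise [i] is the parent of [q] and lies on the path, against [k <= i]. *)
  by have := parent_ltk q; lia.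
move=> S S'; rewrite !inE => misS misS' eqt.
have eq_path (i : 'I_n) : i < k -> (i \in S) = (i \in S').
  by move=> ltik; rewrite -!nth_trace // eqt.
apply/setP => i; have [/eq_path //|leki] := ltnP i k.
have ltpk := parent_ltk i.
have ltpn : parent i < n by lia.
by rewrite !(leaf_in _ i (Ordinal ltpn)) // eq_path.
Qed.

(** An upper bound suffices for sharpness: the general lower bound gives the reverse inequality. *)
Lemma caterpillar_mis_le : mis caterpillar <= fib k.+2.
Proof.
rewrite mis_setT -size_sparse_seqs cardE -(size_map trace).
apply: uniq_leq_size => [|_ /mapP[S + ->]]; rewrite ?mem_enum ?inE.
  rewrite map_inj_in_uniq ?enum_uniq // => S S'; rewrite !mem_enum.
  exact: trace_inj_mis.
case/is_misP => _ indS _.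
by have := sparse_seqsP (trace_sparse indS); rewrite size_mkseq.
Qed.

End Caterpillar.

Theorem theorem1 :
  (forall (T : sgraph) (n alpha : nat),
     tree T -> #|{: T}| = n -> independence_number T = alpha ->
     fib (n - alpha + 2) <= mis T)
  /\
  (forall n alpha : nat,
     2 <= n -> uphalf n <= alpha -> alpha <= n - 1 ->
     exists T : sgraph,
       [/\ tree T, #|{: T}| = n, independence_number T = alpha &
           mis T = fib (n - alpha + 2)]).
Proof.
have lower (T : sgraph) (n alpha : nat) :
    tree T -> #|{: T}| = n -> independence_number T = alpha ->
    fib (n - alpha + 2) <= mis T.
  move=> [_ acT] <- <-; rewrite mis_setT alpha_in_setT -cardsT.
  exact: fib_leq_card_mis.
split=> // n alpha n_ge2 le_half le_alpha.
pose k := n - alpha.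
have k_gt0 : 0 < k by rewrite /k; lia.
(* The hypothesis [uphalf n <= alpha] says that there are at least as many leaves as path
   vertices. *)
have lekn : k.*2 <= n by rewrite /k; move: le_half; rewrite leq_uphalf_double; lia.
have alphaE : independence_number (caterpillar k n) = alpha.
  by rewrite caterpillar_alpha // /k; lia.
have treeT := caterpillar_tree k_gt0 lekn.
exists (caterpillar k n); split=> //; first exact: card_ord.
apply/eqP; rewrite eqn_leq [X in _ && X]lower ?card_ord // andbT.
by rewrite addn2 caterpillar_mis_le.
Qed.
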